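(* Let $\mathbb{K}$ be a field of characteristic zero, $S=\mathbb{K}[x_1,x_2,x_3,x_4]$ with the standard grading, and $I\subset S$ a homogeneous ideal containing no nonzero linear form such that $A=S/I$ is an Artinian complete intersection with $H$-vector $(1,4,k,k,4,1)$ for some integer $k$. Then the nonzero graded Betti numbers $b_{i,j}$ of $A$ over $S$ are exactly $$b_{0,0}=1,\quad b_{1,2}=3,\quad b_{1,3}=1,\quad b_{2,4}=3,\quad b_{2,5}=3,\quad b_{3,6}=1,\quad b_{3,7}=3,\quad b_{4,9}=1,$$ and all other $b_{i,j}$ are zero. In particular, the $H$-vector of $A$ is $(1,4,7,7,4,1)$.
   Context: The $H$-vector of an Artinian graded algebra $A=S/I$ is $(1,h_1,\dots,h_s)$, where $h_i=\dim_{\mathbb{K}}A_i$ and $s$ is the socle degree, i.e. the largest $i$ with $A_i\neq 0$. The algebra $A=S/I$ is a complete intersection if $I$ is generated by a regular sequence of homogeneous forms (four forms, since $A$ is Artinian). The graded Betti numbers $b_{i,j}$ of $A$ are defined by the minimal graded free resolution of $A$ over $S$, whose $i$-th module is $F_i\simeq\bigoplus_j S(-j)^{b_{i,j}}$; equivalently $b_{i,j}=\dim_{\mathbb{K}}\operatorname{Tor}_i^S(A,\mathbb{K})_j$. *)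

(* Defs.v *)
From HB Require Import structures.
From mathcomp Require Import all_boot all_order all_algebra.
From mathcomp Require Import mpoly.

Set Implicit Arguments.
Unset Strict Implicit.
Unset Printing Implicit Defensive.

Import GRing.Theory.

Local Open Scope ring_scope.

Section Defs.

Variables (K : fieldType) (n : nat).

Local Notation S := {mpoly K[n]}.

Implicit Types (I J : S -> Prop) (fs : seq S).

Definition is_ideal I : Prop :=
  [/\ I 0, (forall p q, I p -> I q -> I (p + q))
    & (forall a p, I p -> I (a * p))].

Definition homogeneous_ideal I : Prop :=
  is_ideal I /\ forall p d, I p -> I (pihomog mdeg d p).

Definition no_linear_form I : Prop :=
  forall l : S, l \is 1.-homog -> I l -> l = 0.

Definition ideal_gen fs (p : S) : Prop :=
  exists c : 'I_(size fs) -> S, p = \sum_(i < size fs) c i * fs`_i.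

(* The ring S/I is Artinian; its ideals are the J/I with J an ideal of S
   containing I. *)
Definition artinian_quotient I : Prop :=
  forall J : nat -> S -> Prop,
    (forall m, is_ideal (J m)) ->
    (forall m p, I p -> J m p) ->
    (forall m p, J m.+1 p -> J m p) ->
    exists N, forall m, (N <= m)%N -> forall p, J m p <-> J N p.

Definition regular_sequence fs : Prop :=
  (forall i, (i < size fs)%N ->
     forall p, ideal_gen (take i fs) (p * fs`_i) -> ideal_gen (take i fs) p)
  /\ ~ ideal_gen fs 1.

Definition complete_intersection I : Prop :=
  exists fs, [/\ forall f, f \in fs -> exists d, f \is d.-homog,
    regular_sequence fs & forall p, I p <-> ideal_gen fs p].

(* dim_K (S/I)_d = h, stated as (S/I)_d = S_d / (I \cap S_d) being isomorphic
   to K^h. *)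
Definition graded_dim I (d h : nat) : Prop :=
  exists phi : {linear dhomog n K d -> 'rV[K]_h},
    (forall v, exists p, phi p = v) /\
    (forall p, phi p = 0 <-> I (mpoly_of_dhomog p)).

(* The out-of-range value 0 of nth says that (S/I)_d = 0 for d >= size h, and
   the last condition that size h - 1 is the socle degree. *)
Definition H_vector I (h : seq nat) : Prop :=
  (forall d, graded_dim I d (nth 0%N h d)) /\ last 0%N h != 0%N.

(* p lies in the degree d part of S, for d in Z *)
Definition zhomog (d : int) (p : S) : Prop :=
  if d is Posz e then p \is e.-homog else p = 0.

(* The data of a complex ... -> F_1 -> F_0 of free modules, with
   F_i = \bigoplus_(l < rk i) S(- shift i l), together with F_0 -> S/I.
   Elements of F_i are row vectors, and differentials act by right
   multiplication; diff i goes from F_(i+1) to F_i. The map F_0 -> S/I is given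
   by representatives in S of the images of the basis. *)
Record free_complex := FreeComplex {
  rk : nat -> nat;
  shift : forall i, 'I_(rk i) -> int;
  diff : forall i, 'M[S]_(rk i.+1, rk i);
  aug : 'cV[S]_(rk 0)
}.

Definition augmentation (F : free_complex) (v : 'rV[S]_(rk F 0)) : S :=
  (v *m aug F) 0 0.

(* The basis element l of F_i has degree shift i l, so degree-preserving maps
   have entries of degree the difference of the shifts. *)
Definition graded_complex (F : free_complex) : Prop :=
  (forall l : 'I_(rk F 0), zhomog (shift l) (aug F l 0)) /\
  (forall i (l : 'I_(rk F i.+1)) (m : 'I_(rk F i)),
     zhomog (shift l - shift m) (diff F i l m)).

Definition resolves (F : free_complex) I : Prop :=
  [/\ forall p, exists v : 'rV[S]_(rk F 0), I (p - augmentation v),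
      forall v : 'rV[S]_(rk F 0),
        I (augmentation v) <-> exists w, v = w *m diff F 0
    & forall i (v : 'rV[S]_(rk F i.+1)),
        v *m diff F i = 0 <-> exists w, v = w *m diff F i.+1].

(* F_(i+1) is mapped into m F_i, with m = (x_1, ..., x_n) the polynomials with
   zero constant term. *)
Definition minimal_complex (F : free_complex) : Prop :=
  forall i l m, (diff F i l m)@_0%MM = 0.

Definition minimal_graded_free_resolution I (F : free_complex) : Prop :=
  [/\ graded_complex F, resolves F I & minimal_complex F].

Definition shift_mult (F : free_complex) (i : nat) (j : int) : nat :=
  #|[set l : 'I_(rk F i) | shift l == j]|.

(* The family b consists of the graded Betti numbers of S/I. Existence of a
   minimal resolution and independence of its choice are part of the
   definition. *)
Definition graded_betti_numbers I (b : nat -> int -> nat) : Prop :=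
  (exists F, minimal_graded_free_resolution I F) /\
  (forall F, minimal_graded_free_resolution I F ->
     forall i j, shift_mult F i j = b i j).

End Defs.

(* Main.v *)
Require Import Defs.
From HB Require Import structures.
From mathcomp Require Import all_boot all_order all_algebra.
From mathcomp Require Import mpoly.
From mathcomp Require Import zify.

(* Multiplication by a form f of degree d that is regular modulo a homogeneous
   ideal J is an injection of S/J, shifted by d, into S/J with cokernel
   S/(J + (f)). So it multiplies the Hilbert series by 1 - t^d, and the mapping
   cone of f on a minimal resolution of S/J is a minimal resolution of
   S/(J + (f)). For generators of degrees d_1, ..., d_r of I this gives
     (1 + 4t + k t^2 + k t^3 + 4t^4 + t^5) (1 - t)^4 = prod_i (1 - t^(d_i)).
   Comparing the orders of vanishing at t = 1 gives r = 4, the degrees of both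
   sides give sum_i d_i = 9, and d_i >= 2 forces the degrees 2, 2, 2, 3;
   cancelling (1 - t)^4 and setting t = 1 gives 10 + 2k = 24. The iterated
   cones, i.e. the Koszul complex, then carry the stated shifts. Two minimal
   resolutions have the same shifts because the comparison maps between them
   are inverse to each other modulo the maximal ideal. *)

Set Implicit Arguments.
Unset Strict Implicit.
Unset Printing Implicit Defensive.

Import GRing.Theory Num.Theory.

Local Open Scope ring_scope.

(** * Uniqueness of the graded Betti numbers *)

Section Graded.
Variables (K : fieldType) (n : nat).
Local Notation S := {mpoly K[n]}.
Implicit Types (p q : S) (I J : S -> Prop).

(** Multiplication by [q] shifts each homogeneous component of [p] by [e], so only the component of
    degree [d - e] reaches degree [d]. *)
Lemma pihomogM e d p q : q \is e.-homog ->
  pihomog mdeg d (p * q) = if (e <= d)%N then pihomog mdeg (d - e) p * q else 0.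
Proof.
move=> hq; rewrite {1}(pihomog_partitionE (mf := mdeg) (leqnn (mmeasure mdeg p))).
rewrite mulr_suml raddf_sum /=.
have hi i : pihomog mdeg i p * q \is (i + e).-homog by apply/dhomogM/hq/pihomogP.
set k := mmeasure mdeg p; case: leqP => [le_ed|lt_da]; last first.
  by apply: big1 => i _; apply: (pihomog_ne0 _ (hi i)); lia.
have [lt_k|le_k] := ltnP (d - e) k.
  rewrite (bigD1 (Ordinal lt_k)) //= pihomog_dE; last first.
    by have := hi (d - e)%N; rewrite subnK.
  rewrite big1 ?addr0 // => i /eqP ne; apply: (pihomog_ne0 _ (hi i)).
  by apply/eqP=> eid; apply: ne; apply: val_inj => /=; lia.
rewrite big1 => [|i _]; last by apply: (pihomog_ne0 _ (hi i)); case: i => /= i; lia.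
rewrite (_ : pihomog _ _ p = 0) ?mul0r //.
rewrite pihomogE big_seq_cond big1 // => m /andP[hm /eqP em].
by have := mmeasure_mnm_lt mdeg hm; rewrite -/k em ltnNge le_k.
Qed.

(** Differences of shifts can be negative; the component is then zero, in accordance with
    [zhomog]. *)
Definition zpi (d : int) p : S := if d is Posz e then pihomog mdeg e p else 0.

Lemma zpi_sum d (T : finType) (f : T -> S) :
  zpi d (\sum_i f i) = \sum_i zpi d (f i).
Proof. by case: d => e /=; [rewrite raddf_sum | rewrite big1]. Qed.

Lemma zpiB d p q : zpi d (p - q) = zpi d p - zpi d q.
Proof. by case: d => e /=; [rewrite raddfB | rewrite subr0]. Qed.

Lemma zpi0 d : zpi d 0 = 0.
Proof. by rewrite -[0 in LHS](subrr 0) zpiB subrr. Qed.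

Lemma zpi_homog d p : zhomog d (zpi d p).
Proof. by case: d => e //=; apply: pihomogP. Qed.

Lemma zpi_id d p : zhomog d p -> zpi d p = p.
Proof. by case: d => e /=; [apply: pihomog_dE | move->]. Qed.

Lemma zpiM a d p q : zhomog a q -> zpi d (p * q) = zpi (d - a) p * q.
Proof.
case: a => a /= => [hq|->]; last by rewrite !mulr0 zpi0.
case: d => d; last first.
  by rewrite (_ : Negz d - a%:Z = Negz (d + a)) ?mul0r //; lia.
rewrite /= (pihomogM _ _ hq); case: leqP => h.
  by rewrite (_ : d%:Z - a%:Z = Posz (d - a)) //; lia.
by rewrite (_ : d%:Z - a%:Z = Negz (a - d).-1) ?mul0r //; lia.
Qed.

Lemma zhomog0 d : zhomog d (0 : S).
Proof. by case: d => e //=; apply: rpred0. Qed.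

Lemma zhomogD d p q : zhomog d p -> zhomog d q -> zhomog d (p + q).
Proof. by case: d => e /=; [apply: rpredD | move=> -> ->; rewrite addr0]. Qed.

Lemma zhomogN d p : zhomog d p -> zhomog d (- p).
Proof. by case: d => e /=; [rewrite dhomogN | move=> ->; rewrite oppr0]. Qed.

Lemma zhomog_sum d (T : finType) (f : T -> S) :
  (forall i, zhomog d (f i)) -> zhomog d (\sum_i f i).
Proof.
by move=> h; apply: big_ind; [apply: zhomog0 | apply: zhomogD | move=> i _].
Qed.

Lemma zhomogM a b p q : zhomog a p -> zhomog b q -> zhomog (a + b) (p * q).
Proof.
move=> hp hq; rewrite -[p * q](_ : zpi (a + b) (p * q) = _); first exact: zpi_homog.
by rewrite (zpiM _ _ hq) addrK zpi_id.
Qed.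

Lemma zhomog_coef0 d p : zhomog d p -> p@_0%MM != 0 -> d = 0.
Proof.
case: d => d /= => [hp|->]; last by rewrite mcoeff0 eqxx.
apply: contra_neq_eq => d0; apply: (dhomog_nemf_coeff hp).
by rewrite mf0; lia.
Qed.

Definition graded_mx (a b : nat) (s : 'I_a -> int) (t : 'I_b -> int)
  (M : 'M[S]_(a, b)) := forall l m, zhomog (s l - t m) (M l m).

Lemma graded_mulmx a b c (s : 'I_a -> int) (t : 'I_b -> int) (u : 'I_c -> int)
    (M : 'M[S]_(a, b)) (N : 'M[S]_(b, c)) :
  graded_mx s t M -> graded_mx t u N -> graded_mx s u (M *m N).
Proof.
move=> hM hN l m; rewrite !mxE; apply: zhomog_sum => j.
by rewrite -[s l](subrK (t j)) -addrA; apply: zhomogM.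
Qed.

Lemma row_factor_mx a b c (E : 'M[S]_(b, c)) (M : 'M[S]_(a, c)) :
  (forall l, exists w, row l M = w *m E) -> exists W, M = W *m E.
Proof.
case/fin_all_exists => w hw; exists (\matrix_l w l); apply/row_matrixP => l.
by rewrite row_mul rowK.
Qed.

(** Projecting each entry of [W] to its expected degree preserves the product, because [M] and [E]
    are already homogeneous. *)
Lemma graded_factor a b c (s : 'I_a -> int) (t : 'I_b -> int) (u : 'I_c -> int)
    (M : 'M[S]_(a, c)) (W : 'M[S]_(a, b)) (E : 'M[S]_(b, c)) :
  graded_mx s u M -> graded_mx t u E -> M = W *m E ->
  exists2 W', graded_mx s t W' & M = W' *m E.
Proof.
move=> hM hE eM; exists (\matrix_(l, m) zpi (s l - t m) (W l m)).
  by move=> l m; rewrite mxE; apply: zpi_homog.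
apply/matrixP=> l m; rewrite -[LHS](zpi_id (hM l m)) eM !mxE zpi_sum.
by apply: eq_bigr => j _; rewrite (zpiM _ _ (hE j m)) mxE opprB subrKA.
Qed.

(** Reduction modulo the maximal ideal; minimality says that it kills the differentials. *)
Definition cst_mx a b (M : 'M[S]_(a, b)) : 'M[K]_(a, b) := map_mx (mcoeff 0%MM) M.

Lemma cst_mxM a b c (M : 'M[S]_(a, b)) (N : 'M[S]_(b, c)) :
  cst_mx (M *m N) = cst_mx M *m cst_mx N.
Proof. exact: map_mxM. Qed.

Lemma is_idealN I p : is_ideal I -> I p -> I (- p).
Proof. by case=> _ _ hM hp; rewrite -mulN1r; apply: hM. Qed.

Lemma is_idealB I p q : is_ideal I -> I p -> I q -> I (p - q).
Proof.
by move=> hI hp hq; have [_ hD _] := hI; apply: hD => //; apply: is_idealN.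
Qed.

Lemma is_ideal_sum I (T : finType) (f : T -> S) :
  is_ideal I -> (forall i, I (f i)) -> I (\sum_i f i).
Proof. by case=> h0 hD _ h; apply: big_ind. Qed.

Lemma is_ideal_subl I p q : is_ideal I -> I (p - q) -> I p <-> I q.
Proof.
move=> hI hpq; have [_ hD _] := hI; split=> h.
  by rewrite (_ : q = p - (p - q)); [apply: is_idealB | rewrite opprB addrC subrK].
by rewrite -(subrK q p); apply: hD.
Qed.

Lemma zpi_ideal I d p : homogeneous_ideal I -> I p -> I (zpi d p).
Proof. by case=> -[? _ _] h hp; case: d => e //=; apply: h. Qed.

(** * Comparison maps between two minimal resolutions *)

Section Comparison.

Variable I : S -> Prop.
Hypothesis homI : homogeneous_ideal I.

Let idI : is_ideal I. Proof. by case: homI. Qed.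

Lemma augmentation_mulmx (F : free_complex K n) a (M : 'M[S]_(a, rk F 0)) v :
  augmentation (v *m M) = \sum_l v 0 l * augmentation (row l M).
Proof.
rewrite /augmentation -mulmxA mxE; apply: eq_bigr => l _; congr (_ * _).
by rewrite -row_mul [RHS]mxE.
Qed.

Lemma augmentation1 (F : free_complex K n) l : augmentation (row l 1%:M) = aug F l 0.
Proof. by rewrite /augmentation -row_mul mul1mx !mxE. Qed.

Lemma augmentationB (F : free_complex K n) u v :
  augmentation (u - v) = augmentation u - @augmentation _ _ F v.
Proof. by rewrite /augmentation mulmxBl !mxE. Qed.

Lemma augmentationZ (F : free_complex K n) a v :
  augmentation (a *: v) = a * @augmentation _ _ F v.
Proof. by rewrite /augmentation -scalemxAl mxE. Qed.

Lemma resolves_factor (F : free_complex K n) i a (M : 'M[S]_(a, rk F i.+1)) :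
  resolves F I -> M *m diff F i = 0 -> exists W, M = W *m diff F i.+1.
Proof.
case=> _ _ hex hM; apply: row_factor_mx => l; apply/hex.
by rewrite -row_mul hM row0.
Qed.

Lemma resolves_factor0 (F : free_complex K n) a (M : 'M[S]_(a, rk F 0)) :
  resolves F I -> (forall l, I (augmentation (row l M))) ->
  exists W, M = W *m diff F 0.
Proof. by case=> _ hex _ hM; apply: row_factor_mx => l; apply/hex. Qed.

Lemma diff_diff (F : free_complex K n) i :
  resolves F I -> diff F i.+1 *m diff F i = 0.
Proof.
case=> _ _ hex; apply/row_matrixP=> l; rewrite row_mul row0; apply/hex.
by exists (row l 1%:M); rewrite -row_mul mul1mx.
Qed.

Lemma augmentation_diff (F : free_complex K n) (v : 'rV_(rk F 1)) :
  resolves F I -> I (augmentation (v *m diff F 0)).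
Proof. by case=> _ hex _; apply/hex; exists v. Qed.

(* One degree of the comparison: M is F_i -> G_i, N is G_i -> F_i, M extends to
   degree i + 1, and N after M is homotopic to the identity, with h the
   component F_i -> F_(i+1) of the homotopy. The last clause is the
   conclusion drawn from the homotopy and minimality. *)
Definition comparison (F G : free_complex K n) i
    (M : 'M[S]_(rk F i, rk G i)) (N : 'M[S]_(rk G i, rk F i)) : Prop :=
  [/\ graded_mx (@shift _ _ F i) (@shift _ _ G i) M,
      exists W, diff F i *m M = W *m diff G i,
      exists h, diff F i *m (M *m N - 1%:M) = diff F i *m (h *m diff F i)
    & cst_mx (M *m N) = 1%:M].

Lemma cst_mx_minimal_l (F : free_complex K n) i a (h : 'M[S]_(a, rk F i.+1)) :
  minimal_complex F -> cst_mx (h *m diff F i) = 0.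
Proof.
move=> hF; rewrite cst_mxM (_ : cst_mx (diff F i) = 0) ?mulmx0 //.
by apply/matrixP=> l m; rewrite !mxE hF.
Qed.

Lemma cst_mx_minimal_r (F : free_complex K n) i a (h : 'M[S]_(rk F i, a)) :
  minimal_complex F -> cst_mx (diff F i *m h) = 0.
Proof.
move=> hF; rewrite cst_mxM (_ : cst_mx (diff F i) = 0) ?mul0mx //.
by apply/matrixP=> l m; rewrite !mxE hF.
Qed.

Lemma cst_mx_eq1 a (M N : 'M[S]_a) : M - 1%:M = N -> cst_mx N = 0 -> cst_mx M = 1%:M.
Proof.
move/eqP; rewrite subr_eq => /eqP -> hN.
by rewrite /cst_mx raddfD /= -/(cst_mx N) hN add0r map_mx1.
Qed.

(** The image of each basis element of [F_0] is lifted to [G_0]; projecting the lift to the right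
    degree keeps it a lift, since [I] is homogeneous. *)
Lemma lift0_exists (F G : free_complex K n) :
  minimal_graded_free_resolution I F -> minimal_graded_free_resolution I G ->
  exists2 M, graded_mx (@shift _ _ F 0) (@shift _ _ G 0) M &
    forall v, I (augmentation v - augmentation (v *m M)).
Proof.
move=> [[gF _] _ _] [[gG _] [hG _ _] _].
have h l : exists w : 'rV[S]_(rk G 0),
    (forall m, zhomog (shift l - shift m) (w 0 m)) /\ I (aug F l 0 - augmentation w).
  have [w hw] := hG (aug F l 0).
  exists (\row_m zpi (shift l - shift m) (w 0 m)).
  split=> [m|]; first by rewrite mxE; apply: zpi_homog.
  have := zpi_ideal (shift l) homI hw; rewrite zpiB (zpi_id (gF l)).
  rewrite /augmentation !mxE zpi_sum; congr (I (_ - _)).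
  by apply: eq_bigr => m _; rewrite (zpiM _ _ (gG m)) mxE.
have [w hw] := fin_all_exists h; exists (\matrix_l w l).
  by move=> l m; rewrite mxE; have [] := hw l.
move=> v; rewrite augmentation_mulmx -{1}[v]mulmx1 augmentation_mulmx -sumrB.
apply: (is_ideal_sum idI) => l; rewrite -mulrBr; case: idI => _ _; apply.
by rewrite augmentation1 rowK; have [] := hw l.
Qed.

(** [M *m N - 1%:M] lands in the kernel of the augmentation, hence factors through [diff F 0]; the
    factor is the homotopy, and minimality kills the constant terms. *)
Lemma comparison0 (F G : free_complex K n)
    (M : 'M[S]_(rk F 0, rk G 0)) (N : 'M[S]_(rk G 0, rk F 0)) :
  minimal_graded_free_resolution I F -> minimal_graded_free_resolution I G ->
  graded_mx (@shift _ _ F 0) (@shift _ _ G 0) M ->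
  (forall v, I (augmentation v - augmentation (v *m M))) ->
  (forall v, I (augmentation v - augmentation (v *m N))) ->
  comparison M N.
Proof.
move=> [_ rF mF] [_ rG _] gM hM hN.
have [h eh] : exists h, M *m N - 1%:M = h *m diff F 0.
  apply: (resolves_factor0 rF) => l; rewrite raddfB /= augmentationB.
  rewrite -opprB; apply: (is_idealN idI).
  rewrite row_mul -(subrKA (augmentation (row l M))).
  case: idI => _ + _; apply; last exact: hN.
  by have := hM (row l 1%:M); rewrite -row_mul mul1mx.
split=> //; last exact: cst_mx_eq1 eh (cst_mx_minimal_l _ mF).
  apply: (resolves_factor0 rG) => l; rewrite row_mul.
  apply/(is_ideal_subl idI (hM _)).
  by rewrite -[diff F 0]mul1mx row_mul; apply: augmentation_diff.
by exists h; rewrite eh.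
Qed.

Lemma liftS_exists (F G : free_complex K n) i
    (M : 'M[S]_(rk F i, rk G i)) (N : 'M[S]_(rk G i, rk F i)) :
  minimal_graded_free_resolution I F -> minimal_graded_free_resolution I G ->
  comparison M N ->
  exists2 M', graded_mx (@shift _ _ F i.+1) (@shift _ _ G i.+1) M' &
    diff F i *m M = M' *m diff G i.
Proof.
move=> [[_ gF] _ _] [[_ gG] _ _] [gM [W eW] _ _].
apply: (graded_factor _ (gG i) eW); exact: graded_mulmx (gF i) gM.
Qed.

(** The chain map identities and the homotopy [h] show that [M' *m N' - 1%:M - diff F i *m h] is
    killed by [diff F i]; exactness then gives the next component [h']. *)
Lemma comparisonS (F G : free_complex K n) i
    (M : 'M[S]_(rk F i, rk G i)) (N : 'M[S]_(rk G i, rk F i)) M' N' :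
  minimal_graded_free_resolution I F -> minimal_graded_free_resolution I G ->
  comparison M N ->
  graded_mx (@shift _ _ F i.+1) (@shift _ _ G i.+1) M' ->
  diff F i *m M = M' *m diff G i -> diff G i *m N = N' *m diff F i ->
  comparison M' N'.
Proof.
move=> [_ rF mF] [_ rG _] [_ _ [h eh] _] gM' eM' eN'.
have [h' eh'] : exists h', M' *m N' - 1%:M - diff F i *m h = h' *m diff F i.+1.
  apply: (resolves_factor rF).
  rewrite !mulmxBl -(mulmxA M') -eN' mulmxA -eM' mul1mx -!mulmxA -eh.
  by rewrite mulmxBr mulmx1 subrr.
split=> //.
- by apply: (resolves_factor rG); rewrite -mulmxA -eM' mulmxA (diff_diff _ rF) mul0mx.
(* Left multiplication by [diff F i.+1] removes the term with [h], since consecutive differentials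
   compose to zero. *)
- exists h'; rewrite -eh' [in RHS]mulmxBr.
  by rewrite [X in _ = _ - X]mulmxA (diff_diff _ rF) mul0mx subr0.
move/eqP: eh'; rewrite subr_eq => /eqP eh'; apply: (cst_mx_eq1 eh').
by rewrite /cst_mx raddfD /= -!/(cst_mx _) cst_mx_minimal_l ?cst_mx_minimal_r ?addr0.
Qed.

Lemma comparison_exists (F G : free_complex K n) i :
  minimal_graded_free_resolution I F -> minimal_graded_free_resolution I G ->
  exists M N, @comparison F G i M N /\ @comparison G F i N M.
Proof.
move=> hF hG; elim: i => [|i [M [N [cMN cNM]]]].
  have [M gM hM] := lift0_exists hF hG; have [N gN hN] := lift0_exists hG hF.
  by exists M, N; split; apply: comparison0.
have [M' gM' eM'] := liftS_exists hF hG cMN.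
have [N' gN' eN'] := liftS_exists hG hF cNM.
exists M', N'.
by split; [apply: (comparisonS hF hG cMN) | apply: (comparisonS hG hF cNM)].
Qed.

End Comparison.

Lemma shift_multE (F : free_complex K n) i j :
  shift_mult F i j = (\sum_(l : 'I_(rk F i)) (shift l == j))%N.
Proof.
rewrite /shift_mult -sum1_card big_mkcond /=; apply: eq_bigr => l _.
by rewrite inE; case: eqP.
Qed.

(* Both sides are traces of P * M * N and M * P' * N, for the projections
   P and P' onto the generators of degree j, which M intertwines. *)
Lemma shift_mult_unique I (F G : free_complex K n) :
  [pchar K] =i pred0 -> homogeneous_ideal I ->
  minimal_graded_free_resolution I F -> minimal_graded_free_resolution I G ->
  forall i j, shift_mult F i j = shift_mult G i j.
Proof.
move=> char0 homI hF hG i j.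
have [M [N [[gM _ _ cMN] [gN _ _ cNM]]]] := comparison_exists homI i hF hG.
(* Characteristic zero turns equality of traces in [K] into equality of multiplicities. *)
have natr_inj (a b : nat) : a%:R = b%:R :> K -> a = b.
  have h0 := (pcharf0P K).1 char0.
  wlog le_ab : a b / (a <= b)%N.
    by move=> h e; case: (leqP a b) => [|/ltnW] /h; [apply | move=> ->].
  by move=> e; have := h0 (b - a)%N; rewrite natrB // e subrr eqxx; lia.
apply: natr_inj; rewrite !shift_multE !natr_sum.
pose c l m := (M l m)@_0%MM * (N m l)@_0%MM.
have sumF l : \sum_m c l m = 1.
  have /matrixP/(_ l l) := cMN; rewrite cst_mxM !mxE eqxx; apply: etrans.
  by apply: eq_bigr => m _; rewrite !mxE.
have sumG m : \sum_l c l m = 1.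
  have /matrixP/(_ m m) := cNM; rewrite cst_mxM !mxE eqxx; apply: etrans.
  by apply: eq_bigr => l _; rewrite !mxE mulrC.
transitivity (\sum_l \sum_m (shift l == j)%:R * c l m).
  by apply: eq_bigr => l _; rewrite -mulr_sumr sumF mulr1.
rewrite exchange_big; apply: eq_bigr => m _ /=.
rewrite -[RHS]mulr1 -(sumG m) mulr_sumr; apply: eq_bigr => l _; rewrite /c.
(* A nonzero constant entry has degree 0, so [l] and [m] have equal shifts. *)
have [->|/(zhomog_coef0 (gM l m)) /eqP] := eqVneq (M l m)@_0%MM 0.
  by rewrite mul0r !mulr0.
by rewrite subr_eq0 => /eqP ->.
Qed.

End Graded.

(** * Mapping cones *)

Section Cone.
Variables (K : fieldType) (n : nat).
Local Notation S := {mpoly K[n]}.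
Implicit Types (p q f : S) (I J : S -> Prop) (F : free_complex K n).

Definition add_gen J f p : Prop := exists q a, J q /\ p = q + a * f.

Lemma add_gen_ideal J f : is_ideal J -> is_ideal (add_gen J f).
Proof.
case=> h0 hD hM; split.
- by exists 0, 0; rewrite mul0r addr0.
- move=> _ _ [q [a [hq ->]]] [q' [a' [hq' ->]]]; exists (q + q'), (a + a').
  by split; [apply: hD | rewrite mulrDl addrACA].
move=> b _ [q [a [hq ->]]]; exists (b * q), (b * a).
by split; [apply: hM | rewrite mulrDr mulrA].
Qed.

Lemma add_gen_homogeneous J f d :
  f \is d.-homog -> homogeneous_ideal J -> homogeneous_ideal (add_gen J f).
Proof.
move=> hf [idJ hJ]; split=> [|_ e [q [a [hq ->]]]]; first exact: add_gen_ideal.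
exists (pihomog mdeg e q), (zpi (e%:Z - d%:Z) a); split; first exact: hJ.
by rewrite pihomogD; congr (_ + _); apply: (zpiM (a := d%:Z) e%:Z).
Qed.

Definition regular_mod J f : Prop := forall p, J (p * f) -> J p.

Section ConeDef.
Variables (F : free_complex K n) (f : S) (d : int).

(** Mapping cone of multiplication by [f] from [F(-d)] to [F]: its term [i + 1] is [F_(i+1)] plus
    [F_i(-d)]. *)
Definition cone_rk i : nat := if i is j.+1 then (rk F j.+1 + rk F j)%N else rk F 0.

Definition cone_shift i : 'I_(cone_rk i) -> int :=
  match i with
  | 0 => @shift _ _ F 0
  | j.+1 => fun l => match split l with inl a => shift a | inr b => shift b + d end
  end.

(** The sign on the lower right block makes consecutive differentials compose to zero. *)
Definition cone_diff i : 'M[S]_(cone_rk i.+1, cone_rk i) :=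
  match i with
  | 0 => col_mx (diff F 0) f%:M
  | j.+1 => block_mx (diff F j.+1) 0 f%:M (- diff F j)
  end.

Definition cone := @FreeComplex K n cone_rk cone_shift cone_diff (aug F).

End ConeDef.

Lemma cone_shift_l F f d i (l : 'I_(rk F i.+1)) :
  @shift _ _ (cone F f d) i.+1 (lshift (rk F i) l) = shift l.
Proof. by rewrite /= (unsplitK (inl l)). Qed.

Lemma cone_shift_r F f d i (l : 'I_(rk F i)) :
  @shift _ _ (cone F f d) i.+1 (rshift (rk F i.+1) l) = shift l + d.
Proof. by rewrite /= (unsplitK (inr l)). Qed.

Lemma shift_mult_coneS F f d i j :
  shift_mult (cone F f d) i.+1 j = (shift_mult F i.+1 j + shift_mult F i (j - d)%R)%N.
Proof.
rewrite !shift_multE big_split_ord /=; congr (_ + _)%N; apply: eq_bigr => l _.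
  by rewrite (unsplitK (inl l)).
by rewrite (unsplitK (inr l)) eq_sym -subr_eq eq_sym.
Qed.

Lemma scalar_graded F f d i (l m : 'I_(rk F i)) : zhomog d f ->
  zhomog (shift l + d - shift m) (f%:M l m).
Proof.
move=> hf; rewrite mxE; have [->|_] := eqVneq l m; last by rewrite mulr0n; apply: zhomog0.
by rewrite mulr1n addrAC subrr add0r.
Qed.

Lemma cone_graded F f d : graded_complex F -> zhomog d f -> graded_complex (cone F f d).
Proof.
move=> [hA hD] hf; split=> // -[|i] l.
  case: (@split_ordP _ _ l) => l' -> m.
    by rewrite cone_shift_l /= col_mxEu; apply: hD.
  by rewrite cone_shift_r /= col_mxEd; apply: scalar_graded.
case: (@split_ordP _ _ l) => l' -> m; case: (@split_ordP _ _ m) => m' ->.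
- by rewrite !cone_shift_l /= block_mxEul; apply: hD.
- by rewrite /= block_mxEur mxE; apply: zhomog0.
- by rewrite cone_shift_l cone_shift_r /= block_mxEdl; apply: scalar_graded.
rewrite !cone_shift_r /= block_mxEdr mxE; apply: zhomogN.
by rewrite opprD addrACA subrr addr0; apply: hD.
Qed.

Lemma cone_minimal F f d : minimal_complex F -> f@_0%MM = 0 ->
  minimal_complex (cone F f d).
Proof.
move=> hF hf; have hs a (l m : 'I_a) : (f%:M l m)@_0%MM = 0.
  by rewrite mxE; case: eqP; rewrite ?mulr1n ?mulr0n ?mcoeff0.
case=> [|i] l.
  by case: (@split_ordP _ _ l) => l' -> m /=; rewrite (col_mxEu, col_mxEd).
case: (@split_ordP _ _ l) => l' -> m; case: (@split_ordP _ _ m) => m' -> /=.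
- by rewrite block_mxEul.
- by rewrite block_mxEur mxE mcoeff0.
- by rewrite block_mxEdl.
by rewrite block_mxEdr mxE mcoeffN hF oppr0.
Qed.

(** Once [v2] is a boundary up to sign, [v1 - f *: w2] is a cycle of [F], and exactness of [F]
    applies. *)
Lemma cone_exact F J f i (v1 : 'rV[S]_(rk F i.+1)) (v2 : 'rV[S]_(rk F i)) w2 :
  resolves F J ->
  v2 = - (w2 *m diff F i) -> v1 *m diff F i + f *: v2 = 0 ->
  exists w1, v1 = w1 *m diff F i.+1 + f *: w2.
Proof.
move=> [_ _ hF] e2 e1; have [w1 e] : exists w1, v1 - f *: w2 = w1 *m diff F i.+1.
  by apply/hF; rewrite mulmxBl -scalemxAl -e1 e2 scalerN.
by exists w1; rewrite -e subrK.
Qed.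

(** Regularity of [f] gives exactness at term 1 of the cone, where the second component must be
    shown to have augmentation in [J]; at higher terms exactness comes from that of [F]. *)
Lemma cone_resolves F J f d : is_ideal J -> regular_mod J f ->
  resolves F J -> resolves (cone F f d) (add_gen J f).
Proof.
move=> idJ reg hF; have [hA h0 hS] := hF; have [J0 JD JM] := idJ; split.
- move=> p; have [v hv] := hA p; exists v, (p - @augmentation _ _ F v), 0.
  by rewrite mul0r addr0.
- move=> v; split=> [[q [a [hq e]]]|[w]].
    (* Subtracting [f] times a lift [u] of [a] brings the augmentation of [v] into [J]. *)
    have [u hu] := hA a; have [w ew] : exists w, v - f *: u = w *m diff F 0.
      apply/h0; rewrite augmentationB augmentationZ.
      rewrite (e : @augmentation _ _ F v = _) -addrA.
      by rewrite (mulrC a) -mulrBr; apply: JD => //; apply: JM.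
    exists (row_mx w u) => /=.
    by rewrite mul_row_col mul_mx_scalar -ew subrK.
  rewrite -(hsubmxK (w : 'rV_(rk F 1 + rk F 0))) => -> /=.
  rewrite mul_row_col mul_mx_scalar.
  set w1 := lsubmx _; set w2 := rsubmx _.
  exists (@augmentation _ _ F (w1 *m diff F 0)), (@augmentation _ _ F w2).
  split; first exact: augmentation_diff hF.
  by rewrite mulrC -augmentationZ /augmentation /= mulmxDl mxE.
move=> i v; rewrite -(hsubmxK (v : 'rV_(rk F i.+1 + rk F i))).
move: (lsubmx _) (rsubmx _) => {v} v1 v2.
(* Boundaries are described by components uniformly in [i], before the case split on the outgoing
   differential. *)
have key : (exists w : 'rV[S]_(rk F i.+2 + rk F i.+1),
   row_mx v1 v2 = w *m block_mx (diff F i.+1) 0 f%:M (- diff F i)) <->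
   exists w1 w2, v1 = w1 *m diff F i.+1 + f *: w2 /\ v2 = - (w2 *m diff F i).
  split=> [[w]|[w1 [w2 [-> ->]]]].
    rewrite -(hsubmxK w) mul_row_block mul_mx_scalar mulmx0 add0r mulmxN.
    by move=> /eq_row_mx [-> ->]; exists (lsubmx w), (rsubmx w).
  by exists (row_mx w1 w2); rewrite mul_row_block mul_mx_scalar mulmx0 add0r mulmxN.
apply: (iff_trans _ (iff_sym key)) => {key}; split; last first.
  move=> [w1 [w2 [-> ->]]]; case: i v1 v2 w1 w2 => [|i] v1 v2 w1 w2 /=.
    rewrite mul_row_col mul_mx_scalar mulmxDl -mulmxA (diff_diff _ hF) mulmx0.
    by rewrite add0r -scalemxAl scalerN subrr.
  rewrite mul_row_block mul_mx_scalar mulmxDl -mulmxA (diff_diff _ hF) mulmx0.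
  rewrite add0r -scalemxAl scalerN subrr mulmx0 add0r mulNmx mulmxN opprK.
  by rewrite -mulmxA (diff_diff _ hF) mulmx0 row_mx0.
case: i v1 v2 => [|i] v1 v2 /=.
  rewrite mul_row_col mul_mx_scalar => e.
  have [w2 e2] : exists w, v2 = w *m diff F 0.
    apply/h0/reg; rewrite mulrC -augmentationZ.
    have -> : f *: v2 = - v1 *m diff F 0.
      by rewrite mulNmx; apply/eqP; rewrite -addr_eq0 addrC e.
    exact: augmentation_diff hF.
  have e2' : v2 = - (- w2 *m diff F 0) by rewrite mulNmx opprK.
  by have [w1 e1] := cone_exact hF e2' e; exists w1, (- w2).
rewrite mul_row_block mul_mx_scalar mulmx0 add0r mulmxN -row_mx0.
move=> /eq_row_mx [e e'].
have /hS [w2 e2] : v2 *m diff F i = 0 by rewrite -[LHS]opprK e' oppr0.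
have e2' : v2 = - (- w2 *m diff F i.+1) by rewrite mulNmx opprK.
by have [w1 e1] := cone_exact hF e2' e; exists w1, (- w2).
Qed.

End Cone.

(** * Hilbert functions *)

Section Hilbert.
Variables (K : fieldType) (n : nat).
Local Notation S := {mpoly K[n]}.
Implicit Types (f : S) (I J : S -> Prop) (F : free_complex K n).

(** Preimages of the basis vectors give a linear section of [phi], which reduces dimension counts to
    ranks of matrices. *)
Lemma lincomb_surj d h (phi : {linear dhomog n K d -> 'rV[K]_h}) :
  (forall v, exists p, phi p = v) ->
  exists p : 'I_h -> dhomog n K d, forall u : 'rV_h, phi (\sum_i u 0 i *: p i) = u.
Proof.
move=> surj; have [p hp] := fin_all_exists (fun i => surj (delta_mx 0 i)).
exists p => u; rewrite linear_sum [RHS]row_sum_delta; apply: eq_bigr => i _.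
by rewrite linearZ /= hp.
Qed.

Lemma lincomb_mulmx d h h' (phi : {linear dhomog n K d -> 'rV[K]_h'})
    (p : 'I_h -> dhomog n K d) (u : 'rV_h) :
  phi (\sum_i u 0 i *: p i) = u *m \matrix_i phi (p i).
Proof.
rewrite mulmx_sum_row linear_sum; apply: eq_bigr => i _.
by rewrite linearZ /= rowK.
Qed.

Lemma row_free_inj0 (a b : nat) (M : 'M[K]_(a, b)) :
  (forall u : 'rV_a, u *m M = 0 -> u = 0) -> row_free M.
Proof.
move=> h; rewrite -kermx_eq0; apply/eqP/row_matrixP => i; rewrite row0.
by apply: h; apply/sub_kermxP; apply: row_sub.
Qed.

(** A section of [phi] followed by [phi'] is injective, because both maps have the same kernel
    [I_d]. *)
Lemma graded_dim_le I d h h' : graded_dim I d h -> graded_dim I d h' -> (h <= h')%N.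
Proof.
move=> [phi [surj ker]] [phi' [_ ker']]; have [p hp] := lincomb_surj surj.
have /eqP <- : row_free (\matrix_i phi' (p i)); last exact: rank_leq_col.
apply: row_free_inj0 => u; rewrite -lincomb_mulmx => /ker'/ker.
by rewrite hp.
Qed.

Lemma graded_dim_inj I d h h' : graded_dim I d h -> graded_dim I d h' -> h = h'.
Proof.
by move=> H H'; apply/eqP; rewrite eqn_leq (graded_dim_le H H') (graded_dim_le H' H).
Qed.

Lemma graded_dim_equiv I J d h : (forall p, I p <-> J p) ->
  graded_dim I d h -> graded_dim J d h.
Proof.
move=> e [phi [surj ker]]; exists phi; split=> // p.
exact: iff_trans (ker p) (e _).
Qed.

Lemma graded_dim_gen_low J f d e h : homogeneous_ideal J -> f \is d.-homog ->
  (e < d)%N -> graded_dim J e h -> graded_dim (add_gen J f) e h.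
Proof.
move=> [[h0 hD hM] homJ] hf lt_ed [phi [surj ker]]; exists phi; split=> // p.
apply: (iff_trans (ker p)); split=> [hp|[q [a [hq /(congr1 (pihomog mdeg e))]]]].
  by exists (mpoly_of_dhomog p), 0; rewrite mul0r addr0.
rewrite pihomog_dE ?dhomog_is_dhomog // pihomogD (pihomogM _ _ hf) leqNgt lt_ed.
by rewrite addr0 => ->; apply: homJ.
Qed.

(** In coordinates, multiplication by [f] is a matrix [M], injective by regularity, whose cokernel
    is the degree [e + d] part of [S/(J + (f))]. *)
Lemma graded_dim_gen J f d e h h' : homogeneous_ideal J -> f \is d.-homog ->
  regular_mod J f -> graded_dim J (e + d) h -> graded_dim J e h' ->
  (h' <= h)%N /\ graded_dim (add_gen J f) (e + d) (h - h').
Proof.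
move=> [idJ homJ] hf reg [phi [surj ker]] [psi [surj' ker']].
have [q hq] := lincomb_surj surj'.
pose mulf p : dhomog n K (e + d) := DHomog (dhomogM (dhomog_is_dhomog p) hf).
pose M := \matrix_i phi (mulf (q i)).
have phiM (u : 'rV_h') : phi (mulf (\sum_i u 0 i *: q i)) = u *m M.
  rewrite -lincomb_mulmx; congr (phi _); apply: val_inj => /=.
  rewrite !raddf_sum mulr_suml; apply: eq_bigr => i _.
  by rewrite /= -scalerAl.
have phif p : phi (mulf p) = psi p *m M.
  rewrite -phiM; apply/eqP; rewrite -subr_eq0 -raddfB; apply/eqP/ker.
  rewrite raddfB /= -mulrBl mulrC; case: idJ => _ _; apply.
  by rewrite -raddfB; apply/ker'; rewrite raddfB /= hq subrr.
have freeM : row_free M.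
  apply: row_free_inj0 => u; rewrite -phiM => /ker /= /reg /ker'.
  by rewrite hq.
have rkM : \rank (cokermx M) = (h - h')%N by rewrite mxrank_coker (eqP freeM).
split; first by rewrite -(eqP freeM) rank_leq_col.
(* Multiplication by [col_base (cokermx M)] is the projection onto the cokernel, written in exactly
   [\rank (cokermx M)] coordinates. *)
rewrite -rkM; exists [the {linear _ -> _} of mulmxr (col_base (cokermx M)) \o phi].
split=> [v|p] /=.
  have /row_fullP [B hB] := col_base_full (cokermx M).
  by have [p hp] := surj (v *m B); exists p; rewrite hp -mulmxA hB mulmx1.
have -> : (phi p *m col_base (cokermx M) = 0) <-> (phi p <= M)%MS.
  rewrite submxE -[in X in _ <-> X](mulmx_base (cokermx M)) mulmxA.
  split=> [->|/eqP e0]; first by rewrite mul0mx.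
  by apply: (row_free_inj (row_base_free (cokermx M))); rewrite e0 mul0mx.
split=> [/submxP [u]|[g [a [hg e1]]]].
  rewrite -phiM => /eqP; rewrite -subr_eq0 -raddfB => /eqP/ker.
  rewrite raddfB /= => hJ.
  eexists; exists (mpoly_of_dhomog (\sum_i u 0 i *: q i)); split; first exact: hJ.
  by rewrite subrK.
apply/submxP; exists (psi (DHomog (pihomogP mdeg e a))); rewrite -phif.
apply/eqP; rewrite -subr_eq0 -raddfB; apply/eqP/ker; rewrite raddfB /=.
(* It suffices to take the components of degree [e + d] in [p = g + a * f]. *)
suff -> : mpoly_of_dhomog p - pihomog mdeg e a * f = pihomog mdeg (e + d) g.
  exact: homJ.
rewrite -[mpoly_of_dhomog p](pihomog_dE (dhomog_is_dhomog p)) /= e1.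
by rewrite pihomogD (pihomogM _ _ hf) leq_addl !addnK addrK.
Qed.

Lemma graded_dim_zero d : graded_dim (fun p : {mpoly K[n.+1]} => p = 0) d 'C(d + n, d).
Proof.
have [phi lin [g gK Kg]] := @dhomog_vecaxiom n K d.
pose L := GRing.isLinear.Build _ _ _ _ phi lin.
exists (HB.pack_for {linear dhomog n.+1 K d -> 'rV[K]_('C(d + n, d))} phi L).
split=> [v|p] /=; first by exists (g v); apply: Kg.
have phi0 : phi 0 = 0 by have := lin (-1) 0 0; rewrite scaler0 addr0 scaleN1r addNr.
split=> [e|e]; first by rewrite -[p]gK e -phi0 gK.
by rewrite -phi0; congr phi; apply: val_inj.
Qed.

End Hilbert.

(** * Hilbert series *)

Section Series.
Implicit Types (p q r : {poly int}) (h : nat -> int) (ds : seq nat).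

(** Identities of power series are stated as congruences modulo [X^M] between truncations. *)
Definition eq_modX M p q : Prop := forall i, (i < M)%N -> p`_i = q`_i.

Lemma eq_modX_trans M p q r : eq_modX M p q -> eq_modX M q r -> eq_modX M p r.
Proof. by move=> h1 h2 i lt_i; rewrite h1 ?h2. Qed.

Lemma eq_modXM M p q r : eq_modX M p q -> eq_modX M (p * r) (q * r).
Proof.
move=> h i lt_i; rewrite !coefM; apply: eq_bigr => j _; rewrite h //.
by apply: leq_ltn_trans lt_i; rewrite -ltnS.
Qed.

Definition trunc M h : {poly int} := \poly_(i < M) h i.

Lemma trunc_diff M h h' d :
  (forall e, (e < d)%N -> h' e = h e) -> (forall e, h' (e + d)%N = h (e + d)%N - h e) ->
  eq_modX M (trunc M h') (trunc M h * (1 - 'X^d)).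
Proof.
move=> lo hi i lt_i; rewrite mulrBr mulr1 coefB coefMXn !coef_poly lt_i.
case: ltnP => [/lo ->|le_di]; first by rewrite subr0.
by rewrite -{1}(subnK le_di) hi subnK // (leq_ltn_trans (leq_subr _ _)).
Qed.

(** The Hilbert series of the polynomial ring is the inverse of [(1 - t)^(n+1)]: by Pascal's rule, a
    factor [1 - t] turns the sequence for [n + 1] into the one for [n]. *)
Lemma trunc_binomial M n :
  eq_modX M (trunc M (fun e => 'C(e + n, e)%:Z) * (1 - 'X) ^+ n.+1) 1.
Proof.
elim: n => [|n IHn].
  rewrite expr1 -['X]expr1 => i lt_i.
  rewrite -(@trunc_diff M (fun e => 'C(e + 0, e)%:Z) (fun e => (e == 0%N)%:Z) 1) //.
  - by rewrite coef_poly lt_i coef1; case: i lt_i.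
  - by case=> // _; rewrite addn0 binn.
  by move=> e; rewrite !addn0 !binn addn1.
rewrite exprS mulrA => i lt_i; rewrite -IHn //.
apply: (@eq_modXM M _ _ _ _ i lt_i) => j lt_j.
rewrite -['X]expr1 -(@trunc_diff M _ (fun e => 'C(e + n, e)%:Z)) //.
  by case=> // _; rewrite !bin0.
by move=> e; rewrite !addn1 !addSn !addnS !binS; lia.
Qed.

(** If the exponents differed, cancelling the smaller power and evaluating at 1 would make [p] or
    [q] vanish there. *)
Lemma order_at1 p q a b : p.[1] != 0 -> q.[1] != 0 ->
  p * (1 - 'X) ^+ a = q * (1 - 'X) ^+ b -> a = b /\ p = q.
Proof.
have X0 : (1 - 'X : {poly int}) != 0.
  by apply/eqP => /(congr1 (horner^~ 0)); rewrite !hornerE.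
wlog le_ab : a b p q / (a <= b)%N.
  move=> H hp hq e; case: (leqP a b) => [|/ltnW] /H {}H; first exact: H.
  by have [-> ->] := H _ _ hq hp (esym e).
move=> hp hq; rewrite -(subnK le_ab) exprD mulrA.
move=> /mulIf; rewrite expf_neq0 // => /(_ isT) e.
have [E|] := posnP (b - a)%N; first by rewrite E add0n e E expr0 mulr1.
by move=> lt0; move: hp; rewrite e !hornerE subrr expr0n -(prednK lt0) mulr0 eqxx.
Qed.

Lemma sub1Xn d : 1 - 'X^d = (\sum_(i < d) 'X^i) * (1 - 'X) :> {poly int}.
Proof. by rewrite -[LHS]opprB subrX1 -mulNr opprB mulrC. Qed.

Lemma prod_sub1Xn ds : \prod_(d <- ds) (1 - 'X^d) =
  (\prod_(d <- ds) \sum_(i < d) 'X^i) * (1 - 'X) ^+ size ds :> {poly int}.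
Proof.
elim: ds => [|d ds IH]; first by rewrite !big_nil mulr1.
by rewrite !big_cons IH sub1Xn /= exprS mulrACA.
Qed.

Lemma horner1_geom d : (\sum_(i < d) 'X^i : {poly int}).[1] = d%:Z.
Proof.
rewrite horner_sum (eq_bigr (fun=> 1)) ?sumr_const ?card_ord ?natz // => i _.
by rewrite hornerXn expr1n.
Qed.

Lemma size_sub1Xn d : (0 < d)%N -> size (1 - 'X^d : {poly int}) = d.+1.
Proof. by move=> d0; rewrite -opprB size_polyN size_XnsubC. Qed.

Lemma size_prod_sub1Xn ds : all (leq 1) ds ->
  size (\prod_(d <- ds) (1 - 'X^d) : {poly int}) = (sumn ds).+1.
Proof.
elim: ds => [|d ds IH]; first by rewrite big_nil size_poly1.
move=> /= /andP[d0 /IH {}IH].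
rewrite big_cons size_mul -?size_poly_eq0 ?IH ?size_sub1Xn //.
by rewrite addSn addnS.
Qed.

Lemma ci_degrees k ds : all (leq 2) ds ->
  Poly [:: 1; 4; k%:Z; k%:Z; 4; 1] * (1 - 'X) ^+ 4 = \prod_(d <- ds) (1 - 'X^d) ->
  k = 7%N /\
  [\/ ds = [:: 2; 2; 2; 3], ds = [:: 2; 2; 3; 2], ds = [:: 2; 3; 2; 2]
    | ds = [:: 3; 2; 2; 2]]%N.
Proof.
move=> ge2 e; pose P := Poly [:: 1; 4; k%:Z; k%:Z; 4; 1].
(* The last coefficient is 1, so the list is normalised whatever [k] is. *)
have hP : P = [:: 1; 4; k%:Z; k%:Z; 4; 1] :> seq int by apply: (@PolyK _ 0).
have P1 : P.[1] = (10 + 2 * k)%N%:Z.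
  by rewrite /P horner_Poly /=; lia.
have Q1 : (\prod_(d <- ds) \sum_(i < d) 'X^i : {poly int}).[1] = (\prod_(d <- ds) d)%N%:Z.
  rewrite horner_prod (eq_bigr _ (fun d _ => horner1_geom d)) -natz natr_prod.
  by apply: eq_bigr => d _; rewrite natz.
have Q0 : (0 < \prod_(d <- ds) d)%N.
  by rewrite big_seq; apply: prodn_cond_gt0 => d /(allP ge2); lia.
have nzP : P.[1] != 0 by rewrite P1.
have nzQ : (\prod_(d <- ds) \sum_(i < d) 'X^i : {poly int}).[1] != 0 by rewrite Q1; lia.
have [s4 eP] := order_at1 nzP nzQ (etrans e (prod_sub1Xn ds)).
(* Sizes are degrees plus one; comparing them shows that [ds] sums to 5 + 4 = 9. *)
move/(congr1 (fun q : {poly int} => size q)): e.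
rewrite size_prod_sub1Xn; last by apply: sub_all ge2 => d; lia.
have nzX : (1 - 'X) ^+ 4 != 0 :> {poly int}.
  by rewrite expf_neq0 // -size_poly_eq0 -['X]expr1 size_sub1Xn.
rewrite size_mul -/P //; last by rewrite -size_poly_eq0 hP.
rewrite (polySpred nzX).
rewrite size_exp -['X]expr1 size_sub1Xn // hP /=.
have : \prod_(d <- ds) d = (10 + 2 * k)%N.
  by apply/eqP; rewrite -eqz_nat -Q1 -eP -/P P1.
case: ds s4 ge2 {eP Q1 Q0 nzQ} => [|d1 [|d2 [|d3 [|d4 [|? ?]]]]] //= _.
rewrite !big_cons big_nil => /and5P[h1 h2 h3 h4 _] hk hs.
(* Four integers at least 2 with sum 9 are 2, 2, 2, 3 up to order; the order of the generators is
   arbitrary. *)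
have {hs} : [\/ [/\ d1 = 2, d2 = 2, d3 = 2 & d4 = 3],
   [/\ d1 = 2, d2 = 2, d3 = 3 & d4 = 2], [/\ d1 = 2, d2 = 3, d3 = 2 & d4 = 2]
   | [/\ d1 = 3, d2 = 2, d3 = 2 & d4 = 2]]%N.
  have [|] : (d1 = 2 \/ d1 = 3)%N by lia.
    have [|] : (d2 = 2 \/ d2 = 3)%N by lia.
      have [|] : (d3 = 2 \/ d3 = 3)%N by lia.
        by move=> *; apply: Or41; split=> //; lia.
      by move=> *; apply: Or42; split=> //; lia.
    by move=> *; apply: Or43; split=> //; lia.
  by move=> *; apply: Or44; split=> //; lia.
case=> -[e1 e2 e3 e4]; move: hk; rewrite e1 e2 e3 e4 => hk; (split; first by lia).
- exact: Or41.
- exact: Or42.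
- exact: Or43.
exact: Or44.
Qed.

End Series.

(** * Koszul resolutions *)

Section Koszul.
Variables (K : fieldType) (n : nat).
Local Notation S := {mpoly K[n]}.
Implicit Types (f p : S) (fs : seq S) (I J : S -> Prop).

Definition zero_ideal p : Prop := p = 0.

Lemma zero_ideal_homogeneous : homogeneous_ideal zero_ideal.
Proof.
split=> [|p d ->]; last by rewrite /zero_ideal pihomog0.
by split=> // [p q -> ->|a p ->]; rewrite /zero_ideal ?addr0 ?mulr0.
Qed.

(** The ring [S] in homological degree 0, the starting point of the iterated cones. *)
Definition base_complex : free_complex K n :=
  @FreeComplex K n (fun i => (i == 0)%N) (fun _ _ => 0) (fun _ => 0) 1.

Lemma base_complex_resolution : minimal_graded_free_resolution zero_ideal base_complex.
Proof.
split.
- split=> [l|i l m] /=; last by case: l.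
  by rewrite ord1 mxE eqxx; apply: dhomog1.
- have aug_base (v : 'rV_(rk base_complex 0)) : augmentation v = v 0 0.
    by rewrite /augmentation /= mulmx1.
  split=> [p|v|i v].
  + by exists (\row_i p); rewrite aug_base mxE subrr.
  + rewrite aug_base; split=> [e|[w ->]]; last by rewrite /= mulmx0 mxE.
    by exists 0; rewrite mul0mx; apply/rowP=> j; rewrite !ord1 mxE.
  by rewrite /= mulmx0; split=> // _; exists 0; apply/rowP; case.
by move=> i l m /=; rewrite mxE mcoeff0.
Qed.

Lemma mgfr_equiv I J F : (forall p, I p <-> J p) ->
  minimal_graded_free_resolution I F -> minimal_graded_free_resolution J F.
Proof.
move=> e [gF [hA h0 hS] mF]; split=> //; split=> // [p|v].
  by have [v hv] := hA p; exists v; apply/e.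
exact: iff_trans (iff_sym (e _)) (h0 v).
Qed.

Lemma cone_mgfr J f d F : homogeneous_ideal J -> regular_mod J f ->
  f \is d.-homog -> (0 < d)%N -> minimal_graded_free_resolution J F ->
  minimal_graded_free_resolution (add_gen J f) (cone F f d%:Z).
Proof.
move=> [idJ _] reg hf d0 [gF rF mF]; split.
- exact: cone_graded.
- exact: cone_resolves.
apply: cone_minimal => //; apply/eqP; apply: contraTT d0 => nz.
by have [->] := zhomog_coef0 (d := d%:Z) hf nz.
Qed.

(** Generators are added one at a time, in step with the cones; [gen_idealE] identifies the result
    with [ideal_gen]. *)
Definition gen_ideal fs : S -> Prop := foldl (@add_gen K n) zero_ideal fs.

Lemma gen_ideal_rcons fs f : gen_ideal (rcons fs f) = add_gen (gen_ideal fs) f.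
Proof. by rewrite /gen_ideal -cats1 foldl_cat. Qed.

(** Coefficients indexed by all naturals extend to a longer list without transport between ordinal
    types. *)
Lemma ideal_gen_seqP fs p : ideal_gen fs p <->
  exists c : nat -> S, p = \sum_(i < size fs) c i * fs`_i.
Proof.
split=> [[c ->]|[c ->]]; last by exists (fun i => c i).
exists (fun i => if insub i is Some j then c j else 0).
by apply: eq_bigr => i _; rewrite valK.
Qed.

Lemma ideal_gen_rcons fs f p :
  ideal_gen (rcons fs f) p <-> add_gen (ideal_gen fs) f p.
Proof.
split=> [/ideal_gen_seqP [c]|[q [a [/ideal_gen_seqP [c ->] ->]]]].
  rewrite size_rcons big_ord_recr /= nth_rcons ltnn eqxx => ->.
  exists (\sum_(i < size fs) c i * fs`_i), (c (size fs)); split.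
    by apply/ideal_gen_seqP; exists c.
  by congr (_ + _); apply: eq_bigr => i _; rewrite nth_rcons ltn_ord.
apply/ideal_gen_seqP; exists (fun i => if (i < size fs)%N then c i else a).
rewrite size_rcons big_ord_recr /= nth_rcons ltnn eqxx; congr (_ + _).
by apply: eq_bigr => i _; rewrite nth_rcons ltn_ord.
Qed.

Lemma gen_idealE fs p : gen_ideal fs p <-> ideal_gen fs p.
Proof.
elim/last_ind: fs p => [|fs f IH] p.
  split=> [->|/ideal_gen_seqP [c ->]]; last by rewrite big_ord0.
  by apply/ideal_gen_seqP; exists (fun=> 0); rewrite big_ord0.
rewrite gen_ideal_rcons; apply: iff_trans (iff_sym (ideal_gen_rcons fs f p)).
by split=> -[q [a [/IH hq ->]]]; exists q, a.
Qed.

Lemma regular_sequence_rcons fs f : regular_sequence (rcons fs f) ->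
  regular_sequence fs /\ regular_mod (gen_ideal fs) f.
Proof.
move=> [reg prop]; split.
  split=> [i lt_i p|].
    have := reg i; rewrite size_rcons nth_rcons lt_i -cats1 takel_cat ?(ltnW lt_i) //.
    by apply; apply: ltnW.
  move=> h; apply: prop; apply/ideal_gen_rcons; exists 1, 0.
  by split; rewrite ?mul0r ?addr0.
move=> p /gen_idealE hp; apply/gen_idealE; have := reg (size fs) _ p.
rewrite size_rcons nth_rcons ltnn eqxx -cats1 takel_cat // take_size.
by apply.
Qed.

Lemma ideal_gen_ideal fs : is_ideal (ideal_gen fs).
Proof.
split.
- by exists (fun=> 0); rewrite big1 // => i _; rewrite mul0r.
- move=> _ _ [c ->] [c' ->]; exists (fun i => c i + c' i).
  by rewrite -big_split; apply: eq_bigr => i _; rewrite mulrDl.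
move=> a _ [c ->]; exists (fun i => a * c i).
by rewrite mulr_sumr; apply: eq_bigr => i _; rewrite mulrA.
Qed.

(** If the last element were zero, regularity would put 1 in the ideal of the preceding ones,
    against properness. *)
Lemma regular_sequence_neq0 fs f : regular_sequence fs -> f \in fs -> f != 0.
Proof.
elim/last_ind: fs => // fs g IH /[dup] [[_ prop]] /regular_sequence_rcons [regs reg].
rewrite mem_rcons inE => /orP[/eqP ->|]; last exact: IH.
apply/eqP => g0; apply: prop; apply/ideal_gen_rcons.
exists 1, 0; rewrite mul0r addr0; split=> //; apply/gen_idealE/reg.
by rewrite g0 mulr0; apply/gen_idealE; case: (ideal_gen_ideal fs).
Qed.

Lemma ideal_gen_mem fs f : f \in fs -> ideal_gen fs f.
Proof.
move=> hf; have lt_i : (index f fs < size fs)%N by rewrite index_mem.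
exists (fun i => (i == Ordinal lt_i)%:R); rewrite (bigD1 (Ordinal lt_i)) //= eqxx mul1r.
by rewrite nth_index // big1 ?addr0 // => i /negbTE ->; rewrite mul0r.
Qed.

Definition cone_betti (b : nat -> int -> nat) (d : nat) : nat -> int -> nat :=
  fun i j => if i is i'.+1 then (b i j + b i' (j - d%:Z)%R)%N else b 0%N j.

(** The coefficient of [s^i t^j] in the product of the [1 + s t^d] for [d] in [ds]. *)
Definition koszul_betti (ds : seq nat) : nat -> int -> nat :=
  foldl cone_betti (fun i j => ((i == 0%N) && (j == 0)) : nat) ds.

(** Induction on the last generator, with one cone per step; homogeneity of the ideal is carried
    along, and the dimension count uses it again. *)
Lemma koszul_resolution fs (ds : seq nat) : regular_sequence fs ->
  size ds = size fs -> all (leq 1) ds ->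
  (forall i, (i < size fs)%N -> fs`_i \is (nth 0%N ds i).-homog) ->
  homogeneous_ideal (gen_ideal fs) /\
  exists2 F, minimal_graded_free_resolution (gen_ideal fs) F &
    forall i j, shift_mult F i j = koszul_betti ds i j.
Proof.
elim/last_ind: fs ds => [|fs f IH] ds.
  case: ds => // _ _ _ _; split; first exact: zero_ideal_homogeneous.
  exists base_complex; first exact: base_complex_resolution.
  case=> [|i] j; rewrite shift_multE /=; last by rewrite big_ord0.
  by rewrite big_ord1 eq_sym.
case/lastP: ds => [|ds d]; first by rewrite size_rcons.
move=> /regular_sequence_rcons [regs reg]; rewrite !size_rcons => -[sz].
rewrite all_rcons => /andP[d0 ds0] hom.
have [homJ [F hF bF]] : homogeneous_ideal (gen_ideal fs) /\
  exists2 F, minimal_graded_free_resolution (gen_ideal fs) F &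
    forall i j, shift_mult F i j = koszul_betti ds i j.
  apply: IH => // i lt_i; have := hom i; rewrite !nth_rcons sz lt_i; apply.
  exact: ltnW.
have hf : f \is d.-homog.
  by have := hom (size fs); rewrite !nth_rcons sz ltnn eqxx; apply.
rewrite gen_ideal_rcons; split; first exact: add_gen_homogeneous hf homJ.
exists (cone F f d%:Z); first exact: cone_mgfr.
rewrite /koszul_betti -cats1 foldl_cat -/(koszul_betti ds) /=.
by case=> [|i] j; rewrite ?shift_mult_coneS /= -?bF.
Qed.

End Koszul.

(** Adding a generator of degree [d] subtracts the Hilbert function shifted by [d], which multiplies
    the series by [1 - t^d]. *)
Lemma koszul_hilbert (K : fieldType) n (fs : seq {mpoly K[n.+1]}) (ds : seq nat) :
  regular_sequence fs -> size ds = size fs -> all (leq 1) ds ->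
  (forall i, (i < size fs)%N -> fs`_i \is (nth 0%N ds i).-homog) ->
  exists2 h : nat -> nat, forall e, graded_dim (gen_ideal fs) e (h e) &
    forall M, eq_modX M (trunc M (fun e => (h e)%:Z) * (1 - 'X) ^+ n.+1)
                        (\prod_(d <- ds) (1 - 'X^d)).
Proof.
elim/last_ind: fs ds => [|fs f IH] ds.
  case: ds => // _ _ _ _; exists (fun e => 'C(e + n, e)).
    by move=> e; apply: graded_dim_zero.
  by move=> M; rewrite big_nil; apply: trunc_binomial.
case/lastP: ds => [|ds d]; first by rewrite size_rcons.
move=> /regular_sequence_rcons [regs reg]; rewrite !size_rcons => -[sz].
rewrite all_rcons => /andP[d0 ds0] hom.
have hom' i : (i < size fs)%N -> fs`_i \is (nth 0%N ds i).-homog.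
  by move=> lt_i; have := hom i; rewrite !nth_rcons sz lt_i; apply; apply: ltnW.
have hf : f \is d.-homog.
  by have := hom (size fs); rewrite !nth_rcons sz ltnn eqxx; apply.
have [h dim_h ser_h] := IH _ regs sz ds0 hom'.
have [homJ _] := koszul_resolution regs sz ds0 hom'.
pose h' e := if (e < d)%N then h e else (h e - h (e - d))%N.
have dim_shift e := graded_dim_gen homJ hf reg (dim_h (e + d)%N) (dim_h e).
exists h' => [e|M]; rewrite ?gen_ideal_rcons /h'.
  case: ltnP => [lt_ed|le_de]; first exact: (graded_dim_gen_low homJ hf).
  by have [_] := dim_shift (e - d)%N; rewrite subnK.
rewrite -cats1 big_cat big_seq1 /=.
apply: (@eq_modX_trans M _ (trunc M (fun e => (h e)%:Z) * (1 - 'X^d) * (1 - 'X) ^+ n.+1)).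
  apply: eq_modXM; apply: trunc_diff => [e -> //|e].
  (* The subtraction of naturals is exact: injectivity of multiplication by [f] gives
     [h e <= h (e + d)]. *)
  by rewrite ltnNge leq_addl addnK /= -subzn //; have [] := dim_shift e.
by rewrite -mulrA (mulrC (1 - 'X^d)) mulrA; apply: eq_modXM.
Qed.

(** * Numerical evaluation and conclusion *)

(** Expansion of [(1 + s t^2)^3 (1 + s t^3)], the same for each order of the degrees. *)
Lemma koszul_betti_ci (ds : seq nat) i j :
  [\/ ds = [:: 2; 2; 2; 3], ds = [:: 2; 2; 3; 2], ds = [:: 2; 3; 2; 2]
    | ds = [:: 3; 2; 2; 2]]%N ->
  koszul_betti ds i j =
       [fun _ : nat * int => 0%N with
          (0%N, 0%:Z) |-> 1%N,
          (1%N, 2%:Z) |-> 3%N, (1%N, 3%:Z) |-> 1%N,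
          (2%N, 4%:Z) |-> 3%N, (2%N, 5%:Z) |-> 3%N,
          (3%N, 6%:Z) |-> 1%N, (3%N, 7%:Z) |-> 3%N,
          (4%N, 9%:Z) |-> 1%N] (i, j).
Proof.
move=> hds; rewrite /= !xpair_eqE.
case: i => [|[|[|[|[|i]]]]] /=; case: hds => ->; rewrite /koszul_betti /=; 
  try (by []); try (by repeat case: eqP; lia).
Qed.

Lemma poly_of_trunc (s : seq int) (q D : {poly int}) (h : nat -> int) :
  (forall e, h e = s`_e) -> (forall M, eq_modX M (trunc M h * D) q) ->
  Poly s * D = q.
Proof.
(* This bound exceeds [i] and covers all of [s], so the truncation is [Poly s] and coefficient [i]
   is visible. *)
move=> hs hq; apply/polyP => i; pose M := maxn (size s) i.+1.
have <- : (trunc M h * D)`_i = q`_i by apply: hq; rewrite leq_max ltnSn orbT.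
congr (polyseq (_ * _))`_i; apply/polyP => j; rewrite coef_Poly coef_poly hs.
case: ltnP => // le_Mj; rewrite nth_default //.
by apply: leq_trans le_Mj; rewrite leq_maxl.
Qed.

(** A nonzero constant is a unit and would put 1 in the ideal. *)
Lemma regular_sequence_degree_gt0 (K : fieldType) n (fs : seq {mpoly K[n]}) f :
  regular_sequence fs -> f \in fs -> (0 < (msize f).-1)%N.
Proof.
move=> reg hf; have nzf := regular_sequence_neq0 reg hf.
rewrite -ltnS prednK ?lt0n ?msize_poly_eq0 // ltnNge; apply/negP => /msize1_polyC ef.
have [_ []] := reg; have [_ _ hM] := ideal_gen_ideal fs.
have -> : 1 = (f@_0%MM)^-1%:MP * f; last exact: hM (ideal_gen_mem hf).
rewrite [X in _ * X]ef -mpolyCM mulVf //.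
by apply: contraNneq nzf => c0; rewrite ef c0.
Qed.

Theorem theorem4p2 (K : fieldType) (charK0 : [pchar K] =i pred0)
    (I : {mpoly K[4]} -> Prop) (homI : homogeneous_ideal I)
    (nolinI : no_linear_form I) (artI : artinian_quotient I)
    (ciI : complete_intersection I)
    (k : nat) (hI : H_vector I [:: 1; 4; k; k; 4; 1]%N) :
  graded_betti_numbers I
    (fun (i : nat) (j : int) =>
       [fun _ : nat * int => 0%N with
          (0%N, 0%:Z) |-> 1%N,
          (1%N, 2%:Z) |-> 3%N, (1%N, 3%:Z) |-> 1%N,
          (2%N, 4%:Z) |-> 3%N, (2%N, 5%:Z) |-> 3%N,
          (3%N, 6%:Z) |-> 1%N, (3%N, 7%:Z) |-> 3%N,
          (4%N, 9%:Z) |-> 1%N] (i, j))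
  /\ H_vector I [:: 1; 4; 7; 7; 4; 1]%N.
Proof.
have [fs [hom reg eI]] := ciI; pose ds := [seq (msize f).-1 | f <- fs].
have homd f : f \in fs -> f \is ((msize f).-1).-homog.
  by move=> /hom [d /dhomog_msize].
have ge2 : all (leq 2) ds.
  apply/allP => _ /mapP [f hf ->].
  rewrite ltn_neqAle andbC (regular_sequence_degree_gt0 reg hf).
  (* A generator of degree 1 would be a linear form in [I], hence zero. *)
  apply/negP => /eqP e1; have := homd f hf; rewrite -e1 => /nolinI f0.
  by have := regular_sequence_neq0 reg hf; rewrite f0 ?eqxx //; apply/eI/ideal_gen_mem.
have ge1 : all (leq 1) ds by apply: sub_all ge2 => d /ltnW.
have sz : size ds = size fs by rewrite size_map.
have homn i : (i < size fs)%N -> fs`_i \is (nth 0%N ds i).-homog.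
  by move=> lt_i; rewrite (nth_map 0) // homd // mem_nth.
have eJ p : gen_ideal fs p <-> I p.
  by apply: iff_trans (gen_idealE fs p) (iff_sym (eI p)).
have [_ [F hF bF]] := koszul_resolution reg sz ge1 homn.
have [h dim_h ser_h] := koszul_hilbert reg sz ge1 homn.
have [dimI _] := hI.
(* The Hilbert function from the generators and the given [H]-vector measure the same graded
   pieces. *)
have he e : (h e)%:Z = [:: 1; 4; k%:Z; k%:Z; 4; 1]`_e.
  rewrite (graded_dim_inj (graded_dim_equiv eJ (dim_h e)) (dimI e)).
  by case: e => [|[|[|[|[|[|[|e]]]]]]].
have [k7 dsE] := ci_degrees ge2 (poly_of_trunc he ser_h).
split; last by rewrite -k7.
have hFI := mgfr_equiv eJ hF.
(* The Koszul resolution gives existence; any other minimal resolution [G] has the same shifts. *)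
split=> [|G hG i j]; first by exists F.
by rewrite (shift_mult_unique charK0 homI hG hFI) bF koszul_betti_ci.
Qed.
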